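(* Let $G$ be a pseudobounded left topological group and let $d$ be any left-invariant quasi-pseudometric on $G$ generating the topology of $G$. Then $d$ is bounded on $G$, that is, there is a real number $C$ with $d(x,y)\le C$ for all $x,y\in G$.
   Context: A left topological group is a group $G$ endowed with a topology such that for every $g\in G$ the left shift $x\mapsto gx$ is continuous. $G$ is pseudobounded if for any neighborhood $U$ of the identity there exists a positive integer $n$ with $U^n=G$, where $U^n=\{u_1\cdots u_n:u_1,\dots,u_n\in U\}$. A quasi-pseudometric on a set $X$ is a function $d:X\times X\to[0,\infty)$ with $d(x,x)=0$ and $d(x,z)\le d(x,y)+d(y,z)$ for all $x,y,z\in X$ (symmetry is not required). It generates the topology for which, at each point $x$, the balls $\{y\in X:d(x,y)<r\}$, $r>0$, form a neighborhood base. A quasi-pseudometric $d$ on a group $G$ is left-invariant if $d(gx,gy)=d(x,y)$ for all $g,x,y\in G$. *)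

(* Defs.v *)
From HB Require Import structures.
From mathcomp Require Import all_boot all_order all_algebra.
From mathcomp Require Import all_classical all_reals.
From mathcomp Require Import topology_structure.

Set Implicit Arguments.
Unset Strict Implicit.
Unset Printing Implicit Defensive.

Import Order.TTheory GRing.Theory Num.Theory.
Local Open Scope classical_set_scope.
Local Open Scope ring_scope.

HB.structure Definition PreTopologicalGroup := {G of Topological G & Group G}.

HB.mixin Record PreTopologicalGroup_isLeftTopologicalGroup G
    & PreTopologicalGroup G := {
  mulg_continuous : forall g : G, continuous (fun x : G => (g * x)%g)
}.

#[short(type="leftTopologicalGroupType")]
HB.structure Definition LeftTopologicalGroup :=
  {G of PreTopologicalGroup G & PreTopologicalGroup_isLeftTopologicalGroup G}.

(* The set of n-fold products u_0 * ... * u_(n-1) of elements of U, not to be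
   confused with the set of n-th powers of elements of U. *)
Definition set_expg (G : groupType) (U : set G) (n : nat) : set G :=
  [set (\big[*%g/1%g]_(i < n) u i) | u in [set u : 'I_n -> G | forall i, U (u i)]].

Definition pseudobounded (G : leftTopologicalGroupType) : Prop :=
  forall U : set G, nbhs (1%g : G) U ->
    exists n : nat, (0 < n)%N /\ set_expg U n = setT.

Record quasi_pseudometric (R : realType) (X : Type) (d : X -> X -> R) : Prop :=
  QuasiPseudometric {
    qpm_ge0 : forall x y, 0 <= d x y ;
    qpm_refl : forall x, d x x = 0 ;
    qpm_triangle : forall x y z, d x z <= d x y + d y z }.

Definition generates_topology (R : realType) (X : topologicalType)
    (d : X -> X -> R) : Prop :=
  forall x : X,
    nbhs x = filter_from [set r : R | 0 < r] (fun r => [set y | d x y < r]).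

Definition left_invariant (R : realType) (G : groupType) (d : G -> G -> R) : Prop :=
  forall g x y : G, d (g * x)%g (g * y)%g = d x y.

(* Main.v *)
Require Import Defs.
From mathcomp Require Import all_boot all_order all_algebra.
From mathcomp Require Import all_classical all_reals.
From mathcomp Require Import topology_structure.

Local Open Scope ring_scope.

Import Order.TTheory GRing.Theory Num.Theory.

(** By left invariance, only the distances from the identity need a bound. The open unit ball at the
    identity is a neighborhood, so pseudoboundedness writes every element as a product of a fixed
    number [n] of its elements; subadditivity ([left_invariant_dist1_prod]) then gives the bound
    [n]. *)

(* Left invariance turns d(g, gh) into d(1, h), so the triangle inequality
   through g makes h |-> d(1, h) subadditive. *)
Lemma left_invariant_dist1M {R : realType} {G : groupType} {d : G -> G -> R} :
  quasi_pseudometric d -> left_invariant d ->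
  forall g h : G, d 1%g (g * h)%g <= d 1%g g + d 1%g h.
Proof.
move=> hd hinv g h; apply: le_trans (qpm_triangle hd 1%g g (g * h)%g) _.
by rewrite -{2}(mulg1 g) hinv.
Qed.

Lemma left_invariant_dist1_prod {R : realType} {G : groupType}
    {d : G -> G -> R} {n : nat} (u : 'I_n -> G) :
  quasi_pseudometric d -> left_invariant d ->
  d 1%g (\big[*%g/1%g]_(i < n) u i)%g <= \sum_(i < n) d 1%g (u i).
Proof.
move=> hd hinv.
(* The relation [d 1 g <= r] holds for the pair [1], [0] and passes from factors to products and
   sums. *)
apply: (big_ind2 (fun g r => d 1%g g <= r)) => [|g r h s gr hs|//].
  by rewrite (qpm_refl hd).
exact: le_trans (left_invariant_dist1M hd hinv g h) (lerD gr hs).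
Qed.

Theorem proposition5 (R : realType) (G : leftTopologicalGroupType)
  (hG : pseudobounded G)
  (d : G -> G -> R)
  (hd : quasi_pseudometric d)
  (hinv : left_invariant d)
  (hgen : generates_topology d) :
  exists C : R, forall x y : G, d x y <= C.
Proof.
have ball1 : nbhs (1%g : G) [set y | d 1%g y < 1]%classic.
  by rewrite hgen; exists 1 => //=; exact: ltr01.
have [n [_ ballnT]] := hG _ ball1.
exists n%:R => x y; rewrite -(hinv x^-1%g) mulVg.
have : set_expg [set y | d 1%g y < 1]%classic n (x^-1 * y)%g by rewrite ballnT.
case=> u /= u_lt1 <-; apply: le_trans (left_invariant_dist1_prod u hd hinv) _.
(* Writing [n] as a sum of [n] ones allows a termwise comparison. *)
rewrite -[n in n%:R]card_ord -sumr_const; apply: ler_sum => i _.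
exact: ltW.
Qed.
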